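(* Let $n\ge 1$ be an integer and let $\mathcal P_{n-1}$ be the space of complex polynomials of degree at most $n-1$. Then, as linear operators on $\mathcal P_{n-1}$, $$\tilde F_n\,\tilde U_n^{-1}=\tilde V_n^{-1}\,\tilde C_n\,\tilde V_n .$$
   Context: The Euler polynomials $A_k(x)$ are defined by $\frac{A_k(x)}{(1-x)^{k+1}}=\sum_{m\ge0}m^kx^m$ (so $A_0=1$, $A_1=x$, $A_2=x+x^2,\dots$), and for $k\ge1$ we put $\tilde A_k(x)=A_k(x)/x$. All operators below are linear operators on $\mathcal P_{n-1}$ given by their values on the monomials $x^p$, $p=0,1,\dots,n-1$: $\tilde U_n x^p=\frac{1}{n!}(1-x)^{n-1-p}\tilde A_{p+1}(x)$ (this operator is invertible; explicitly $\tilde U_n^{-1}x^p=(x-1)_p[x+1]_{n-p-1}$, where $(\varphi)_k=\varphi(\varphi-1)\cdots(\varphi-k+1)$ and $[\varphi]_k=\varphi(\varphi+1)\cdots(\varphi+k-1)$, both equal to $1$ for $k=0$); $\tilde F_n x^p=(1-x)^{2n+1}\sum_{m\ge1}m^{p+1}\binom{m+n}{n}x^{m-1}$ (a polynomial of degree $\le n-1$); $\tilde V_n x^p=(1+x)^{n-p-1}x^p$ (so $\tilde V_n^{-1}x^p=(1-x)^{n-p-1}x^p$); $\tilde C_n x^p=\frac{(n+p+1)!}{(p+1)!}x^p$. *)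

(* Defs.v *)
From HB Require Import structures.
From mathcomp Require Import all_boot all_order all_algebra.
From mathcomp Require Export reals complex.
From mathcomp Require Import ring zify.
Set Implicit Arguments.
Unset Strict Implicit.
Unset Printing Implicit Defensive.
Import Order.TTheory GRing.Theory Num.Theory.
Local Open Scope ring_scope.

Section Operators.
Variable F : numFieldType.

(* j-th coefficient of the formal power series  q(x) * \sum_m a_m x^m. *)
Definition smul (q : {poly F}) (a : nat -> F) (j : nat) : F :=
  \sum_(i < j.+1) q`_i * a (j - i)%N.

(* A_k = (1 - x)^(k+1) * \sum_(m >= 0) m^k x^m, with 0^0 = 1.  Cutting at degree
   k loses nothing: see [coef_eulerian]. *)
Definition eulerian (k : nat) : {poly F} :=
  \poly_(j < k.+1) smul ((1 - 'X) ^+ k.+1) (fun m => m%:R ^+ k) j.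

Definition teulerian (k : nat) : {poly F} := eulerian k %/ 'X.

Variable n : nat.

(* {poly_n F} is the space of polynomials of degree at most n - 1. *)
Definition mono_fun (v : nat -> {poly F}) (q : {poly_n F}) : {poly_n F} :=
  \sum_(p < n) q`_p *: npolyp n (v p).

Fact mono_fun_is_linear v : linear (mono_fun v).
Proof.
move=> a q r; rewrite /mono_fun scaler_sumr -big_split /=.
apply: eq_bigr => p _.
by rewrite scalerA -scalerDl coefD coefZ.
Qed.
HB.instance Definition _ v :=
  GRing.isLinear.Build F {poly_n F} {poly_n F} _ (mono_fun v)
    (mono_fun_is_linear v).

(* The linear operator with x^p |-> v p for p < n.  The cut [npolyp] is never
   active below: see [tUE], [tFE], [tVE] and [tCE]. *)
Definition mono_op (v : nat -> {poly F}) : 'End({poly_n F}) :=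
  linfun (mono_fun v).

Definition tU : 'End({poly_n F}) :=
  mono_op (fun p => (n`!)%:R^-1 *: ((1 - 'X) ^+ (n - 1 - p) * teulerian p.+1)).

(* The series \sum_(m >= 1) m^(p+1) binom(m+n, n) x^(m-1) is reindexed by
   m = j + 1; its product with (1 - x)^(2n+1) has no term of degree >= n when
   p < n: see [tF_coef_eq0]. *)
Definition tF_coef (p : nat) : nat -> F :=
  smul ((1 - 'X) ^+ (2 * n + 1))
       (fun j => j.+1%:R ^+ p.+1 * 'C(j.+1 + n, n)%:R).

Definition tF : 'End({poly_n F}) :=
  mono_op (fun p => \poly_(j < n) tF_coef p j).

Definition tV : 'End({poly_n F}) :=
  mono_op (fun p => (1 + 'X) ^+ (n - p - 1) * 'X^p).

Definition tC : 'End({poly_n F}) :=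
  mono_op (fun p => ((n + p + 1)`!%:R / (p.+1)`!%:R) *: 'X^p).

End Operators.

Section Facts.
Variable F : numFieldType.
Implicit Types (q r P : {poly F}) (a : nat -> F).

Lemma smulE N q a j : (j < N)%N -> smul q a j = (q * \poly_(i < N) a i)`_j.
Proof.
move=> jN; rewrite coefM; apply: eq_bigr => i _.
by rewrite coef_poly (leq_ltn_trans (leq_subr _ _) jN).
Qed.

Lemma smul_sub1X q a j :
  smul ((1 - 'X) * q) a j = smul q a j - (if j is i.+1 then smul q a i else 0).
Proof.
rewrite !(@smulE j.+1) // mulrBl mul1r mulrBl coefB -mulrA coefXM.
by case: j => [|j] //=; rewrite (@smulE j.+2).
Qed.

Lemma sum_smul_sub1X q a k :
  \sum_(j < k.+1) smul ((1 - 'X) * q) a j = smul q a k.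
Proof.
elim: k => [|k IH].
  by rewrite big_ord_recr big_ord0 smul_sub1X /= add0r subr0.
by rewrite big_ord_recr /= IH smul_sub1X /=; ring.
Qed.

Lemma sum_coef_pow r k N : (size ((1 - 'X) ^+ k * r)%R <= N)%N ->
  \sum_(i < N) ((1 - 'X) ^+ k * r)`_i * i%:R ^+ k = (-1) ^+ k * k`!%:R * r.[1].
Proof.
suff H m q : (size q <= N)%N ->
    \sum_(i < N) q`_i * i%:R ^+ m = (iter m (fun q => 'X * q^`()) q).[1].
  move=> sN; rewrite H //; elim: k r {sN} => [|k IH] r.
    by rewrite /= !expr0 !mul1r.
  rewrite iterSr.
  have -> : 'X * ((1 - 'X) ^+ k.+1 * r)^`() =
    (1 - 'X) ^+ k * ('X * (1 - 'X) * r^`() - k.+1%:R * 'X * r).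
    rewrite derivM deriv_exp derivB derivC derivX -mulr_natl /=.
    by rewrite exprS; ring.
  rewrite IH !(hornerE, hornerMn) factS natrM exprS.
  by ring.
move=> sN; elim: m q sN => [|m IH] q sN.
  rewrite /= (horner_coef_wide _ sN).
  by apply: eq_bigr => i _; rewrite expr0 expr1n.
rewrite iterSr -IH.
  apply: eq_bigr => i _; rewrite coefXM coef_deriv exprS.
  by case: (nat_of_ord i) => [|j] /=; rewrite ?mul0r ?mulr0 // mulrA mulr_natr.
have [->|q0] := eqVneq q 0; first by rewrite deriv0 mulr0 size_poly0.
apply: leq_trans sN; apply: leq_trans (size_polyMleq _ _) _.
by rewrite size_polyX /=; apply: lt_size_deriv.
Qed.

Lemma sum_coef_horner r k N P : (size ((1 - 'X) ^+ k * r)%R <= N)%N ->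
  (size P <= k.+1)%N ->
  \sum_(i < N) ((1 - 'X) ^+ k * r)`_i * P.[i%:R] =
  P`_k * ((-1) ^+ k * k`!%:R * r.[1]).
Proof.
move=> sN sP; under eq_bigr => i _ do rewrite (horner_coef_wide _ sP) mulr_sumr.
rewrite exchange_big big_ord_recr /= big1 ?add0r => [|m _].
  rewrite -(sum_coef_pow sN) mulr_sumr; apply: eq_bigr => i _; ring.
have E : (1 - 'X) ^+ k * r = (1 - 'X) ^+ m * ((1 - 'X) ^+ (k - m) * r).
  by rewrite mulrA -exprD subnKC // ltnW.
under eq_bigr => i _ do rewrite mulrCA.
rewrite -mulr_sumr E sum_coef_pow -?E // hornerM horner_exp !hornerE subrr.
by rewrite expr0n subn_eq0 leqNgt ltn_ord /= ?mulr0 ?mul0r ?mulr0 ?mul0r.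
Qed.

Lemma size_sub1X : size (1 - 'X : {poly F}) = 2%N.
Proof. by rewrite -opprB size_polyN size_XsubC. Qed.

Lemma size_sub1X_exp k : (size ((1 - 'X : {poly F}) ^+ k) <= k.+1)%N.
Proof.
by have := size_poly_exp_leq (1 - 'X : {poly F}) k; rewrite size_sub1X mul1n.
Qed.

Lemma size_Xadd_exp (x : F) k : (size (('X + x%:P) ^+ k) <= k.+1)%N.
Proof.
by have := size_poly_exp_leq ('X + x%:P) k; rewrite size_XaddC mul1n.
Qed.

(* A sequence interpolated by a polynomial P of degree < d that vanishes at
   -1, ..., -(d - s) is killed by (1 - x)^d from degree s on. *)
Lemma smul_eq0 d s P a j : (size P <= d)%N -> (forall m, a m = P.[m%:R]) ->
  (forall i, (0 < i <= d - s)%N -> P.[- i%:R] = 0) -> (s <= j)%N ->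
  smul ((1 - 'X) ^+ d) a j = 0.
Proof.
move=> sP aP P0 sj.
case: d sP P0 => [|d] sP P0.
  move: sP; rewrite size_poly_leq0 => /eqP P00; apply: big1 => i _.
  by rewrite aP P00 horner0 mulr0.
pose Q := P \Po (j%:R%:P - 'X); set q := (1 - 'X) ^+ d.+1.
have sQ : (size Q <= d.+1)%N.
  apply: leq_trans (size_comp_poly_leq _ _) _.
  rewrite -opprB size_polyN size_XsubC muln1.
  by case: (size P) sP.
have Qh i : Q.[i%:R] = P.[j%:R - i%:R] by rewrite horner_comp !hornerE.
have sq : (size (q * 1)%R <= (d.+2 + j.+1))%N.
  by rewrite mulr1 (leq_trans (size_sub1X_exp _)) // leq_addr.
have := sum_coef_horner sq (leqW sQ).
rewrite [Q`_d.+1]nth_default // mul0r => H; rewrite -[RHS]H.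
rewrite [in RHS]addnC big_split_ord /= [X in _ = _ + X]big1 ?addr0 => [|i _].
  apply: eq_bigr => i _; rewrite mulr1 aP Qh natrB //.
  by rewrite -ltnS.
rewrite mulr1 Qh.
have [lt|ge] := ltnP (j.+1 + i) d.+2; last first.
  by rewrite nth_default ?mul0r // (leq_trans (size_sub1X_exp _)).
have -> : j%:R - (j.+1 + i)%:R = - i.+1%:R :> F by rewrite !natrD -!natr1; ring.
rewrite P0 ?mulr0 //; move: lt sj; clear; lia.
Qed.

Lemma coef_eulerian k j :
  (eulerian F k)`_j = smul ((1 - 'X) ^+ k.+1) (fun m => m%:R ^+ k) j.
Proof.
rewrite coef_poly; case: ltnP => // kj.
rewrite (@smul_eq0 _ k.+1 'X^k) ?size_polyXn // => [m|i].
  by rewrite hornerXn.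
by rewrite subnn => /andP[]; case: i.
Qed.

Lemma eulerian_at1 k : (eulerian F k).[1] = k`!%:R.
Proof.
rewrite (horner_coef_wide _ (size_poly _ _)).
under eq_bigr => i _ do rewrite coef_eulerian expr1n mulr1 exprS.
rewrite sum_smul_sub1X /smul.
pose P : {poly F} := (-1) ^+ k *: ('X - k%:R%:P) ^+ k.
have sP : (size P <= k.+1)%N.
  by rewrite (leq_trans (size_scale_leq _ _)) // size_exp_XsubC.
have lP : P`_k = (-1) ^+ k.
  have /monicP : ('X - k%:R%:P : {poly F}) ^+ k \is monic.
    by rewrite monic_exp // monicXsubC.
  by rewrite lead_coefE size_exp_XsubC /= coefZ => ->; rewrite mulr1.
have s1 : (size ((1 - 'X : {poly F}) ^+ k * 1)%R <= k.+1)%N.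
  by rewrite mulr1 size_sub1X_exp.
have := sum_coef_horner s1 sP; rewrite lP.
rewrite hornerC !mulr1 mulrA -expr2 sqrr_sign mul1r => <-.
apply: eq_bigr => i _; rewrite /P hornerZ horner_exp !hornerE.
by rewrite /= -mulrA -exprMn mulN1r opprB natrB // -ltnS.
Qed.

Lemma teulerianE k : (0 < k)%N -> teulerian F k * 'X = eulerian F k.
Proof.
move=> k0; apply/divpK; rewrite -['X]subr0 -polyC0 dvdp_XsubCl.
rewrite rootE horner_coef0 coef_eulerian /smul big_ord1 subn0 expr0n.
by rewrite eqn0Ngt k0 mulr0.
Qed.

Lemma size_teulerian k : (size (teulerian F k.+1) <= k.+1)%N.
Proof.
have [->|h] := eqVneq (teulerian F k.+1) 0; first by rewrite size_poly0.
by rewrite -ltnS -(size_mulX h) teulerianE // size_poly.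
Qed.

Lemma mono_opE n (v : nat -> {poly F}) p : (p < n)%N -> (size (v p) <= n)%N ->
  mono_op n v (npolyp n 'X^p) = v p :> {poly F}.
Proof.
move=> pn sv; rewrite lfunE /= /mono_fun (bigD1 (Ordinal pn)) //= big1.
  by rewrite addr0 coef_npolyp pn coefXn eqxx scale1r npolypK.
move=> i ip; rewrite coef_npolyp ltn_ord coefXn.
by rewrite (negPf (ip : val i != p)) scale0r.
Qed.

Lemma size_sub1X_teulerian n p : (p < n)%N ->
  (size ((1 - 'X) ^+ (n - 1 - p) * teulerian F p.+1)%R <= n)%N.
Proof.
move=> pn; apply: leq_trans (size_polyMleq _ _) _.
have := size_sub1X_exp (n - 1 - p); have := size_teulerian p; move: pn.
by set u := size _; set w := size _; clearbody u w; clear; lia.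
Qed.

Lemma tUE n p : (p < n)%N -> tU F n (npolyp n 'X^p) =
  (n`!)%:R^-1 *: ((1 - 'X) ^+ (n - 1 - p) * teulerian F p.+1) :> {poly F}.
Proof.
move=> pn; apply: mono_opE => //.
by rewrite (leq_trans (size_scale_leq _ _)) // size_sub1X_teulerian.
Qed.

Lemma size_add1X_Xn n p : (p < n)%N ->
  (size ((1 + 'X) ^+ (n - p - 1) * 'X^p : {poly F})%R <= n)%N.
Proof.
move=> pn; apply: leq_trans (size_polyMleq _ _) _.
rewrite addrC size_polyXn; have := size_Xadd_exp 1 (n - p - 1); move: pn.
by set u := size _; clearbody u; clear; lia.
Qed.

Lemma tVE n p : (p < n)%N -> tV F n (npolyp n 'X^p) =
  (1 + 'X) ^+ (n - p - 1) * 'X^p :> {poly F}.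
Proof. by move=> pn; apply: mono_opE => //; apply: size_add1X_Xn. Qed.

Lemma tCE n p : (p < n)%N -> tC F n (npolyp n 'X^p) =
  ((n + p + 1)`!%:R / (p.+1)`!%:R) *: 'X^p :> {poly F}.
Proof.
move=> pn; apply: mono_opE => //.
by rewrite (leq_trans (size_scale_leq _ _)) // size_polyXn.
Qed.

Lemma tFE n p : (p < n)%N ->
  tF F n (npolyp n 'X^p) = \poly_(j < n) tF_coef F n p j :> {poly F}.
Proof. by move=> pn; apply: mono_opE => //; apply: size_poly. Qed.

Lemma tF_coef_eq0 n p j : (p < n)%N -> (n <= j)%N -> tF_coef F n p j = 0.
Proof.
move=> pn nj.
pose P : {poly F} := ('X + 1) ^+ p.+1 *
  ((n`!)%:R^-1 *: \prod_(i < n) ('X + i.+2%:R%:P)).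
have sprod m : size (\prod_(i < m) ('X + i.+2%:R%:P) : {poly F}) = m.+1.
  elim: m => [|m IH]; first by rewrite big_ord0 size_poly1.
  rewrite big_ord_recr /= size_proper_mul ?IH ?size_XaddC ?addn2 //.
  by rewrite lead_coefXaddC mulr1 lead_coef_eq0 -size_poly_eq0 IH.
apply: (@smul_eq0 _ n P) => //.
- apply: leq_trans (size_polyMleq _ _) _.
  have := size_Xadd_exp 1 p.+1; have := size_scale_leq (n`!)%:R^-1
    (\prod_(i < n) ('X + i.+2%:R%:P) : {poly F}).
  rewrite sprod; move: pn.
  by set u := size _; set w := size _; clearbody u w; clear; lia.
- move=> m; rewrite hornerM horner_exp hornerZ !hornerE natr1 /= -mulrA.
  congr (_ * _).
  rewrite horner_prod.
  under eq_bigr => i _ do rewrite hornerD hornerX hornerC -natrD.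
  apply: (canRL (mulKf _)); first by rewrite pnatr_eq0 -lt0n fact_gt0.
  rewrite -natrM mulnC bin_ffact -natr_prod; congr _%:R.
  rewrite ffact_prod (reindex_inj rev_ord_inj) /=; apply: eq_bigr => i _.
  by have := ltn_ord i; lia.
case=> // i /= hi; rewrite hornerM horner_exp hornerZ horner_prod !hornerE.
case: i hi => [|i] hi; first by rewrite addNr expr0n /= !mul0r.
have ilt : (i < n)%N.
  by move: hi; rewrite mul2n -addnn -addnA addKn addn1 ltnS.
by rewrite (bigD1 (Ordinal ilt)) //= hornerD hornerX hornerC addNr mul0r mulr0.
Qed.

Lemma triangular_eq0 (L : {poly F}) x n (B : nat -> {poly F}) (c : nat -> F) :
  L != 0 -> L.[x] = 0 -> (forall p, (B p).[x] != 0) ->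
  \sum_(p < n) c p *: (L ^+ (n.-1 - p) * B p) = 0 ->
  forall p, (p < n)%N -> c p = 0.
Proof.
move=> L0 Lx Bx; elim: n => [//|n IH].
rewrite big_ord_recr /= subnn expr0 mul1r.
have E : \sum_(i < n) c i *: (L ^+ (n - i) * B i) =
  L * \sum_(i < n) c i *: (L ^+ (n.-1 - i) * B i).
  rewrite mulr_sumr; apply: eq_bigr => i _; rewrite -scalerAr mulrA -exprS.
  by case: n i {IH} => [[]//|n] i /=; rewrite subSn // -ltnS.
rewrite E => H; have cn : c n = 0.
  have /eqP := congr1 (horner^~ x) H.
  rewrite !hornerE Lx mul0r add0r mulf_eq0 (negPf (Bx n)) orbF.
  by move/eqP.
move: H; rewrite cn scale0r addr0 => /eqP; rewrite mulf_eq0 (negPf L0) /=.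
move=> /eqP /IH H p; rewrite ltnS leq_eqVlt => /orP[/eqP->//|]; exact: H.
Qed.

Lemma mono_op_inj n (v : nat -> {poly F}) :
  (forall p, (p < n)%N -> (size (v p) <= n)%N) ->
  (forall c : nat -> F, \sum_(p < n) c p *: v p = 0 ->
     forall p, (p < n)%N -> c p = 0) ->
  lker (mono_op n v) == 0%VS.
Proof.
move=> sv vfree; rewrite -subv0; apply/subvP => q; rewrite memv_ker memv0.
move=> /eqP /(congr1 (@polyn F n)); rewrite lfunE /= /mono_fun raddf_sum /=.
move=> H; apply/eqP/npolyP => i; rewrite coef0.
have [ni|lt] := leqP n i; first exact: big_coef_npoly.
apply: (vfree (fun i => q`_i)) => //; rewrite -[RHS]H.
by apply: eq_bigr => p _ /=; rewrite npolypK // sv.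
Qed.

(* inv_lfun is total; by these two lemmas it is the true two-sided inverse at tU
   and tV. *)
Lemma lker_tU n : lker (tU F n) == 0%VS.
Proof.
have nf : n`!%:R != 0 :> F by rewrite pnatr_eq0 -lt0n fact_gt0.
apply: mono_op_inj => [p pn|c H].
  by rewrite (leq_trans (size_scale_leq _ _)) // size_sub1X_teulerian.
apply: (@triangular_eq0 (1 - 'X) 1 n (fun p => teulerian F p.+1)).
- by rewrite -size_poly_eq0 size_sub1X.
- by rewrite !hornerE subrr.
- move=> p; have := congr1 (horner^~ 1) (teulerianE (ltn0Sn p)).
  rewrite hornerM hornerX mulr1 /= => ->.
  by rewrite eulerian_at1 pnatr_eq0 -lt0n fact_gt0.
apply: (scalerI (invr_neq0 nf)); rewrite scaler0 -[RHS]H scaler_sumr.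
by apply: eq_bigr => p _; rewrite !scalerA mulrC subn1.
Qed.

Lemma lker_tV n : lker (tV F n) == 0%VS.
Proof.
apply: mono_op_inj => [p pn|c H]; first exact: size_add1X_Xn.
apply: (@triangular_eq0 (1 + 'X) (-1) n (fun p => 'X^p)).
- by rewrite addrC -size_poly_eq0 size_XaddC.
- by rewrite !hornerE subrr.
- by move=> p; rewrite hornerXn expf_neq0 // oppr_eq0 oner_eq0.
by rewrite -[RHS]H; apply: eq_bigr => p _; rewrite subnAC subn1.
Qed.

End Facts.

(* Main.v *)
(* For q of degree < n one has tU q = (1-x)^(n+1)/n! * \sum_(m>=1) m q(m) x^(m-1)
   and tF q = (1-x)^(2n+1) * \sum_(m>=1) m q(m) binom(m+n, n) x^(m-1).  Put
   f_p = (1-x)^(n-1-p) x^p and g_p = n!/(p+1)! * (x-1)_p, so that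
   m g_p(m) = n! binom(m, p+1).  Since
   binom(m, p+1) binom(m+n, n) is a multiple of binom(m+n, n+p+1), both series
   sum to a power of 1/(1-x) times x^p, and tU g_p = f_p while
   tF g_p = (n+p+1)!/(p+1)! * f_p.  As tV f_p = x^p, the operator tF tU^-1 is
   diagonal in the basis f_p = tV^-1 x^p with the eigenvalues of tC. *)
Require Import Defs.
From mathcomp Require Import all_boot all_order all_algebra.
From mathcomp Require Import ring zify.
Set Implicit Arguments.
Unset Strict Implicit.
Unset Printing Implicit Defensive.
Import Order.TTheory GRing.Theory Num.Theory.
Local Open Scope ring_scope.
Local Open Scope complex_scope.

(** * Products of polynomials with formal series, and binomial series *)

Section Smul.
Variable F : numFieldType.
Implicit Types (q r : {poly F}) (a b : nat -> F).

Lemma eq_smul q a b j :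
  (forall i, (i <= j)%N -> a i = b i) -> smul q a j = smul q b j.
Proof. by move=> ab; apply: eq_bigr => i _; rewrite ab ?leq_subr. Qed.

Lemma smul_comp q r a j : smul (q * r) a j = smul q (smul r a) j.
Proof.
rewrite (@smulE _ j.+1) // -mulrA coefM; apply: eq_bigr => i _.
by rewrite (@smulE _ j.+1) // ltnS leq_subr.
Qed.

Lemma smulZ q c a j : smul q (fun i => c * a i) j = c * smul q a j.
Proof. by rewrite mulr_sumr; apply: eq_bigr => i _; rewrite mulrCA. Qed.

Lemma smul_sum (I : Type) (s : seq I) q (a : I -> nat -> F) j :
  smul q (fun i => \sum_(k <- s) a k i) j = \sum_(k <- s) smul q (a k) j.
Proof.
rewrite exchange_big; apply: eq_bigr => i _.
by rewrite mulr_sumr.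
Qed.

Lemma smul_shift q a j : a 0 = 0 ->
  smul q a j.+1 = smul q (fun i => a i.+1) j.
Proof.
move=> a0; rewrite /smul big_ord_recr /= subnn a0 mulr0 addr0.
by apply: eq_bigr => i _; rewrite subSn // -ltnS.
Qed.

Lemma smul_1sX a j :
  smul (1 - 'X) a j = a j - (if j is i.+1 then a i else 0).
Proof.
have smul1 i : smul 1 a i = a i.
  by rewrite (@smulE _ i.+1) // mul1r coef_poly ltnSn.
by have := smul_sub1X 1 a j; rewrite mulr1 smul1; case: j => // j; rewrite smul1.
Qed.

(** This is the series of x^(d-e) / (1-x)^(d+1). By Pascal's rule one factor 1 - x turns the
    binomials of lower index d+1 into those of lower index d. *)
Lemma smul_bin d e j : (e <= d)%N ->
  smul ((1 - 'X) ^+ d.+1) (fun i => 'C(i + e, d)%:R) j = (j == d - e)%N%:R :> F.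
Proof.
elim: d e j => [|d IH] [|e] j //.
- move=> _; rewrite expr1 smul_1sX; case: j => [|j]; rewrite !bin0 ?subr0 //.
  by rewrite subrr.
- move=> _; rewrite exprSr smul_comp subn0.
  case: j => [|j].
    by rewrite /smul !big_ord_recl !big_ord0 /= !subnn bin0n mulr0 !addr0 mulr0.
  (* For e = 0 the differenced series has no constant term: it is x times the series for d. *)
  rewrite smul_shift; last by rewrite smul_1sX bin0n subrr.
  rewrite eqSS -[d in RHS]subn0 -IH //; apply: eq_smul => i _.
  by rewrite smul_1sX !addn0 binS natrD addrAC subrr add0r.
rewrite ltnS => ed; rewrite exprSr smul_comp subSS -IH //.
apply: eq_smul => i _; rewrite smul_1sX; case: i => [|i].
  (* Nothing is subtracted at index 0; Pascal's rule still applies because ['C(e, d.+1)] vanishes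
     for e <= d. *)
  rewrite !add0n subr0; congr _%:R.
  by rewrite binS bin_small ?add0n.
by rewrite addSn binS natrD addSnnS addrAC subrr add0r.
Qed.

End Smul.

(** * Images under [tU] and [tF] as series in the values q(m) *)

Section Moments.
Variables (F : numFieldType) (n : nat).
Implicit Types (p j : nat) (q : {poly_n F}) (v : nat -> {poly F}).

Lemma coef_mono_op v q j : (forall p, (p < n)%N -> (size (v p) <= n)%N) ->
  (mono_op n v q)`_j = \sum_(p < n) q`_p * (v p)`_j.
Proof.
move=> sv; rewrite lfunE /= /mono_fun raddf_sum coef_sum.
by apply: eq_bigr => p _; rewrite coefZ /= npolypK ?sv.
Qed.

Lemma coef_mono_op_moment v (Q : {poly F}) (w : nat -> F) q j :
    (forall p, (p < n)%N -> (size (v p) <= n)%N) ->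
    (forall p, (p < n)%N ->
       (v p)`_j = smul Q (fun i => i.+1%:R ^+ p.+1 * w i) j) ->
  (mono_op n v q)`_j = smul Q (fun i => i.+1%:R * q.[i.+1%:R] * w i) j.
Proof.
move=> sv vE; rewrite coef_mono_op //.
under eq_bigr => p _ do rewrite vE // -smulZ.
rewrite -(smul_sum _ _ (fun (p : 'I_n) i => q`_p * (i.+1%:R ^+ p.+1 * w i))).
apply: eq_smul => i _; rewrite (horner_coef_wide _ (size_npoly q)).
rewrite mulr_sumr mulr_suml; apply: eq_bigr => p _.
by rewrite exprS; ring.
Qed.

Lemma coef_teulerian p j : (teulerian F p.+1)`_j =
  smul ((1 - 'X) ^+ p.+2) (fun i => i.+1%:R ^+ p.+1) j.
Proof.
have <- : (teulerian F p.+1 * 'X)`_j.+1 = (teulerian F p.+1)`_j.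
  by rewrite coefMX.
by rewrite teulerianE // coef_eulerian smul_shift // expr0n.
Qed.

Lemma coef_tU q j : (tU F n q)`_j =
  n`!%:R^-1 * smul ((1 - 'X) ^+ n.+1) (fun i => i.+1%:R * q.[i.+1%:R]) j.
Proof.
rewrite -smulZ (@coef_mono_op_moment _ ((1 - 'X) ^+ n.+1) (fun=> n`!%:R^-1)).
- by apply: eq_smul => i _; rewrite mulrC.
- move=> p pn.
  by rewrite (leq_trans (size_scale_leq _ _)) // size_sub1X_teulerian.
move=> p pn; rewrite coefZ coefM.
(* The factor (1-x)^(n-1-p) in [tU] raises the Eulerian exponent p+2 to n+1, which no longer depends
   on p. *)
have -> : n.+1 = (n - 1 - p + p.+2)%N by lia.
rewrite exprD smul_comp mulr_sumr; apply: eq_bigr => i _.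
rewrite mulrCA coef_teulerian -smulZ; congr (_ * _).
by apply: eq_smul => k _; rewrite mulrC.
Qed.

Lemma coef_tF q j : (tF F n q)`_j = smul ((1 - 'X) ^+ (2 * n + 1))
  (fun i => i.+1%:R * q.[i.+1%:R] * 'C(i.+1 + n, n)%:R) j.
Proof.
apply: coef_mono_op_moment => p pn; first exact: size_poly.
rewrite coef_poly; case: ltnP => // nj.
by rewrite -[RHS]/(tF_coef F n p j) tF_coef_eq0.
Qed.

Lemma eq_lfun_monomial (f g : 'End({poly_n F})) :
  (forall p, (p < n)%N -> f (npolyp n 'X^p) = g (npolyp n 'X^p)) -> f = g.
Proof.
move=> fg; apply/lfunP => q.
have -> : q = \sum_(p < n) q`_p *: npolyp n 'X^p.
  apply: val_inj; rewrite /= raddf_sum /= -[LHS]coefK.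
  rewrite poly_def (big_ord_widen n (fun i => q`_i *: 'X^i) (size_npoly q)).
  rewrite big_mkcond; apply: eq_bigr => p _.
  rewrite npolypK ?size_polyXn //; case: ltnP => // h.
  by rewrite nth_default // scale0r.
by rewrite !linear_sum; apply: eq_bigr => p _; rewrite !linearZ /= fg.
Qed.

End Moments.

(** * Action of the operators on g_p and f_p *)

Section Diagonalisation.
Variable F : numFieldType.
Implicit Types (n p m : nat) (q : {poly F}).

Lemma prod_natr_sub_ffact p m :
  \prod_(i < p) (m%:R - i%:R) = (m ^_ p)%:R :> F.
Proof.
elim: p => [|p IH]; first by rewrite big_ord0 ffactn0.
rewrite big_ord_recr /= IH ffactnSr natrM.
have [pm|mp] := leqP p m; first by rewrite natrB.
by rewrite ffact_small // !mul0r.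
Qed.

(* The g_p of the header. *)
Definition umono n p : {poly F} :=
  (n`!%:R / p.+1`!%:R) *: \prod_(i < p) ('X - i.+1%:R%:P).

Lemma size_umono n p : (p < n)%N -> (size (umono n p) <= n)%N.
Proof.
move=> pn; rewrite (leq_trans (size_scale_leq _ _)) // size_prod_XsubC.
by rewrite /index_enum -enumT size_enum_ord.
Qed.

Lemma horner_umono n p m :
  m.+1%:R * (umono n p).[m.+1%:R] = n`!%:R * 'C(m.+1, p.+1)%:R :> F.
Proof.
rewrite hornerZ horner_prod.
have -> : \prod_(i < p) ('X - i.+1%:R%:P).[m.+1%:R] = (m ^_ p)%:R :> F.
  rewrite -prod_natr_sub_ffact; apply: eq_bigr => i _.
  by rewrite !hornerE -!natr1; ring.
have f0 : p.+1`!%:R != 0 :> F by rewrite pnatr_eq0 -lt0n fact_gt0.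
rewrite mulrCA -(natrM _ m.+1) -ffactSS -bin_ffact natrM.
by field.
Qed.

Lemma size_sub1X_Xn n p : (p < n)%N ->
  (size ((1 - 'X) ^+ (n - p - 1) * 'X^p : {poly F})%R <= n)%N.
Proof.
move=> pn; apply: leq_trans (size_polyMleq _ _) _.
rewrite size_polyXn; have := size_sub1X_exp F (n - p - 1); move: pn.
by set u := size _; clearbody u; clear; lia.
Qed.

Lemma tU_umono n p : (p < n)%N ->
  tU F n (npolyp n (umono n p)) = npolyp n ((1 - 'X) ^+ (n - p - 1) * 'X^p).
Proof.
move=> pn; apply/npolyP => j; rewrite coef_tU npolypK ?size_umono //.
rewrite npolypK ?size_sub1X_Xn //.
have f0 : n`!%:R != 0 :> F by rewrite pnatr_eq0 -lt0n fact_gt0.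
(* The last p+2 factors collapse the series of ['C(k + 1, p.+1)] to x^p; the others give f_p. *)
have -> : n.+1 = (n - p - 1 + p.+2)%N by lia.
rewrite exprD smul_comp coefM -smulZ; apply: eq_bigr => i _; congr (_ * _).
rewrite (@eq_smul _ _ _ (fun k => n`!%:R * 'C(k + 1, p.+1)%:R)) => [|k _].
  rewrite smulZ mulKf // smul_bin // coefXn.
  by congr (_ == _)%:R; lia.
by rewrite horner_umono addn1.
Qed.

Lemma ffactD m a b : m ^_ (a + b) = (m ^_ a * (m - a) ^_ b)%N.
Proof.
elim: b => [|b IH]; first by rewrite addn0 ffactn0 muln1.
by rewrite addnS !ffactnSr IH subnDA mulnA.
Qed.

(** After multiplication by p!, both sides equal the falling factorial [(m + n) ^_ (n + p)], split
    after its first n factors. *)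
Lemma mul_bin_fact n p m :
  n`!%:R * 'C(m, p)%:R * 'C(m + n, n)%:R =
  (n + p)`!%:R / p`!%:R * 'C(m + n, n + p)%:R :> F.
Proof.
have f0 : p`!%:R != 0 :> F by rewrite pnatr_eq0 -lt0n fact_gt0.
have H : (n`! * p`! * 'C(m, p) * 'C(m + n, n))%N =
         ((n + p)`! * 'C(m + n, n + p))%N.
  rewrite [RHS]mulnC bin_ffact ffactD addnK -!bin_ffact; ring.
have /(congr1 (fun k => k%:R : F)) := H; rewrite !natrM => {}H.
apply: (mulfI f0); transitivity ((n + p)`!%:R * 'C(m + n, n + p)%:R : F).
  by rewrite -H; ring.
by field.
Qed.

Lemma tF_umono n p : (p < n)%N -> tF F n (npolyp n (umono n p)) =
  ((n + p + 1)`!%:R / p.+1`!%:R) *: npolyp n ((1 - 'X) ^+ (n - p - 1) * 'X^p).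
Proof.
move=> pn; apply/npolyP => j; rewrite coef_tF npolypK ?size_umono //.
rewrite coefZ /= npolypK; last exact: size_sub1X_Xn.
(* Here [smul_bin] is used with d = n+p+1 and e = n+1, so the collapsed series is again x^p. *)
have -> : (2 * n + 1)%N = (n - p - 1 + (n + p.+1).+1)%N by lia.
rewrite exprD smul_comp coefM -smulZ; apply: eq_bigr => i _; congr (_ * _).
rewrite (@eq_smul _ _ _ (fun k => (n + p.+1)`!%:R / p.+1`!%:R *
    'C(k + n.+1, n + p.+1)%:R)) => [|k _].
  rewrite smulZ -addnA addn1 smul_bin; last by lia.
  by rewrite coefXn; congr (_ * (_ == _)%:R); lia.
by rewrite horner_umono mul_bin_fact addSnnS.
Qed.

(* (1+x)^m q(x/(1+x)), where 1 - x becomes 1/(1+x): hence [homog_sub1X]. *)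
Definition homog m q : {poly F} :=
  \sum_(k < m.+1) q`_k *: ((1 + 'X) ^+ (m - k) * 'X^k).

Lemma homog_sub1X m q : (size q <= m.+1)%N ->
  homog m.+1 ((1 - 'X) * q) = homog m q.
Proof.
move=> sq; rewrite /homog mulrBl mul1r.
under eq_bigr => k _ do rewrite coefB coefXM scalerBl.
rewrite big_split /= sumrN big_ord_recr /= [q`_m.+1]nth_default // scale0r addr0.
rewrite [X in _ - X]big_ord_recl /= scale0r add0r -sumrB.
apply: eq_bigr => k _; rewrite /bump /= add1n subSS subSn; last by rewrite -ltnS.
by rewrite -scalerBr; congr (_ *: _); rewrite !exprS; ring.
Qed.

Lemma homog_sub1X_Xn k p : homog (k + p) ((1 - 'X) ^+ k * 'X^p) = 'X^p.
Proof.
elim: k => [|k IH].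
  rewrite expr0 mul1r add0n /homog big_ord_recr big1 /= => [|i _].
    by rewrite add0r coefXn eqxx subnn expr0 mul1r scale1r.
  by rewrite coefXn (ltn_eqF (ltn_ord i)) scale0r.
rewrite addSn exprS -mulrA homog_sub1X // (leq_trans (size_polyMleq _ _)) //.
by rewrite size_polyXn addnS /= -addSn leq_add2r size_sub1X_exp.
Qed.

(** On polynomials of degree below n, [tV] acts as [homog n.-1]. *)
Lemma tV_sub1X_Xn n p : (p < n)%N ->
  tV F n (npolyp n ((1 - 'X) ^+ (n - p - 1) * 'X^p)) = npolyp n 'X^p.
Proof.
move=> pn; apply: val_inj; rewrite /= npolypK ?size_polyXn //.
rewrite -[RHS](homog_sub1X_Xn (n - p - 1) p).
have -> : (n - p - 1 + p)%N = n.-1 by lia.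
rewrite /homog lfunE /= /mono_fun raddf_sum /= prednK; last by lia.
apply: eq_bigr => k _ /=; rewrite !npolypK ?size_sub1X_Xn ?size_add1X_Xn //.
by congr (_ *: (_ ^+ _ * _)); lia.
Qed.

End Diagonalisation.

Theorem theorem7 (R : realType) (n : nat) (hn : (1 <= n)%N) :
  (tF R[i] n \o (tU R[i] n)^-1 = (tV R[i] n)^-1 \o tC R[i] n \o tV R[i] n)%VF.
Proof.
(* Composing with tV^-1 on the right makes the test on monomials x^p a test on the eigenvectors
   f_p. *)
have E : (tF R[i] n \o (tU R[i] n)^-1 \o (tV R[i] n)^-1 =
          (tV R[i] n)^-1 \o tC R[i] n)%VF.
  apply: eq_lfun_monomial => p pn; rewrite !comp_lfunE.
  have -> : tC R[i] n (npolyp n 'X^p) =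
      ((n + p + 1)`!%:R / p.+1`!%:R) *: npolyp n 'X^p.
    by apply: val_inj; rewrite /= tCE // npolypK ?size_polyXn.
  rewrite linearZ /= -tV_sub1X_Xn // lker0_lfunK ?lker_tV //.
  by rewrite -tU_umono // lker0_lfunK ?lker_tU // tF_umono // tU_umono.
by rewrite -E -(comp_lfunA (_ \o _)%VF) lker0_compVf ?lker_tV // comp_lfun1r.
Qed.
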